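(* Let $n\ge1$, $d\ge2$, $\ell\ge1$, $K\ge\ell+1$, and let $$\mathcal{E}^-(\mathbf{x})=\tfrac12\sum_{i=2}^{d}\mathbf{v}_i^\top \mathbf{x}^{\otimes i},\qquad \mathcal{E}^+(\mathbf{x})=\tfrac12\sum_{i=2}^{d}\mathbf{w}_i^\top \mathbf{x}^{\otimes i}$$ be polynomial energy functions on $\mathbb{R}^n$ with symmetric coefficients and with $\mathbf{V}_2=\mathrm{unvec}(\mathbf{v}_2)$, $\mathbf{W}_2=\mathrm{unvec}(\mathbf{w}_2)$ symmetric positive definite. Let $\mathbf{\Xi}=\mathrm{diag}(\xi_1(0),\dots,\xi_n(0))$ and $\Phi(\mathbf{z})=\mathbf{T}_1\mathbf{z}+\mathbf{T}_2\mathbf{z}^{\otimes2}+\cdots+\mathbf{T}_K\mathbf{z}^{\otimes K}$ be the input-normal/output-diagonal quantities defined in the context. Let $$\xi_i(z_i)=\xi_i(0)+c_i^{(1)}z_i+c_i^{(2)}z_i^2+\cdots+c_i^{(\ell)}z_i^\ell,\qquad i=1,\dots,n,$$ and $\mathbf{c}_k=[c_1^{(k)},\dots,c_n^{(k)}]^\top$. Suppose the coefficients $\mathbf{c}_1,\dots,\mathbf{c}_\ell$ are determined by matching coefficients in the output-diagonal relation $2\,\mathcal{E}^+(\Phi(\mathbf{z}))=\sum_{i=1}^n z_i^2\,\xi_i(z_i)^2$; that is, for every $i\in\{1,\dots,n\}$ and $k\in\{1,\dots,\ell\}$, the coefficient of the monomial $z_i^{k+2}$ is the same on both sides. Then $$\mathbf{c}_1=\mathbf{\Xi}^{-1}\Big(\mathrm{vec}(\mathbf{T}_2^\top\mathbf{W}_2\mathbf{T}_1)+\tfrac12(\mathbf{T}_1^{\otimes3})^\top\mathbf{w}_3\Big)_{\mathcal{I}_1},$$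 with $\mathcal{I}_1=\{\,j \mid j=(i-1)(n^2+n)+i,\ i=1,\dots,n\}$, and in general, for $1\le k\le\ell$, $$\mathbf{c}_k=\tfrac12\,\mathbf{\Xi}^{-1}\Big[(\mathbf{C}_k)_{\mathcal{I}_k}-\sum_{\substack{i,j\ge1\\ i+j=k}}\mathbf{c}_i\odot\mathbf{c}_j\Big],\qquad \mathbf{C}_k=\sum_{\substack{i,j\ge1\\ i+j=k+2}}\mathrm{vec}\big(\mathbf{T}_j^\top\mathbf{W}_2\mathbf{T}_i\big)+\sum_{i=3}^{k+2}\mathcal{T}_{i,k+2}^\top\mathbf{w}_i,$$ where $\mathcal{I}_k=\{\,j\mid j=(i-1)\sum_{l=1}^{k+1}n^l+i,\ i=1,\dots,n\}$.
   Context: $\mathbf{x}^{\otimes k}$ denotes the $k$-fold Kronecker product of a vector or matrix; $\mathrm{vec}$ stacks the columns of a matrix and $\mathrm{unvec}$ is its inverse ($\mathrm{unvec}(\mathbf{v}_2)\in\mathbb{R}^{n\times n}$, and $\mathrm{unvec}(\mathbf{M}_k)\in\mathbb{R}^{n^k\times n}$ for $\mathbf{M}_k\in\mathbb{R}^{n^{k+1}}$). $\odot$ is the componentwise (Hadamard) product. For a vector $\mathbf{C}$ and an index set $\mathcal{I}=\{j_1<\dots<j_n\}$, $(\mathbf{C})_{\mathcal{I}}\in\mathbb{R}^n$ is the vector of entries $C_{j_1},\dots,C_{j_n}$ (1-based indexing). By convention $\mathbf{v}_i=\mathbf{w}_i=\mathbf{0}$ for $i>d$. A vector $\mathbf{w}\in\mathbb{R}^{n^i}$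 has symmetric coefficients if $\mathbf{w}^\top(\mathbf{a}_1\otimes\cdots\otimes\mathbf{a}_i)$ is invariant under permutations of the vectors $\mathbf{a}_1,\dots,\mathbf{a}_i\in\mathbb{R}^n$. For matrices $\mathbf{T}_j\in\mathbb{R}^{n\times n^j}$ and $l\ge m\ge1$, $\mathcal{T}_{m,l}=\sum_{i_1,\dots,i_m\ge1,\ i_1+\cdots+i_m=l}\mathbf{T}_{i_1}\otimes\cdots\otimes\mathbf{T}_{i_m}\in\mathbb{R}^{n^m\times n^l}$. Input-normal/output-diagonal quantities: let $\mathbf{V}_2=\mathbf{R}\mathbf{R}^\top$, $\mathbf{W}_2=\mathbf{L}\mathbf{L}^\top$ be Cholesky factorizations and $\mathbf{L}^\top\mathbf{R}^{-\top}=\mathcal{U}\mathbf{\Xi}\mathcal{V}^\top$ a singular value decomposition with $\mathbf{\Xi}=\mathrm{diag}(\xi_1(0),\dots,\xi_n(0))$, $\xi_i(0)>0$. Set $\mathbf{T}_1=\mathbf{R}^{-\top}\mathcal{V}$ and, for $k\ge2$, $\mathbf{T}_k=-\frac12\mathbf{T}_1\,\mathrm{unvec}(\mathbf{M}_k)^\top$, where $\mathbf{M}_k=\sum_{i,j>1,\ i+j=k+1}\mathrm{vec}(\mathbf{T}_j^\top\mathbf{V}_2\mathbf{T}_i)+\sum_{i=3}^{k+1}\mathcal{T}_{i,k+1}^\top\mathbf{v}_i$. The functions $\xi_i(z_i)$ are called the singular value functions of the input-normal form. *)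

(* Defs.v *)
From HB Require Import structures.
From mathcomp Require Import all_boot all_order all_fingroup all_algebra.
From mathcomp Require Import reals.
From mathcomp Require Import mxtens mpoly.
Set Implicit Arguments.
Unset Strict Implicit.
Unset Printing Implicit Defensive.
Import Order.TTheory GRing.Theory Num.Theory.
Local Open Scope ring_scope.

Section Kronecker.
Variable R : comNzRingType.

Definition kronpow m (x : 'cV[R]_m) (k : nat) : 'cV[R]_(m ^ k) :=
  castmx (erefl, exp1n k) (x ^t k).

(* a_0 ⊗ ... ⊗ a_(k-1) *)
Fixpoint kronv m k : ('I_k -> 'cV[R]_m) -> 'cV[R]_(m ^ k) :=
  if k is k'.+1 then fun a =>
    castmx (esym (expnS m k'), erefl 1%N)
      (a ord0 *t kronv (fun i => a (lift ord0 i)))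
  else fun=> 1%:M.

Definition symmetric_coef m k (u : 'cV[R]_(m ^ k)) : Prop :=
  forall (s : 'S_k) (a : 'I_k -> 'cV[R]_m),
    u^T *m kronv (fun i => a (s i)) = u^T *m kronv a.

(* Column stacking: with 0-based indices, A i j is the entry j * m + i. *)
Definition vec m p (A : 'M[R]_(m, p)) : 'cV[R]_(p * m) :=
  \col_a A (mxtens_unindex a).2 (mxtens_unindex a).1.

Definition unvec m p (u : 'cV[R]_(p * m)) : 'M[R]_(m, p) :=
  \matrix_(i, j) u (mxtens_index (j, i)) 0.

Lemma vecK m p : cancel (@vec m p) (@unvec m p).
Proof. by move=> A; apply/matrixP => i j; rewrite !mxE mxtens_indexK. Qed.

Lemma unvecK m p : cancel (@unvec m p) (@vec m p).
Proof.
move=> u; apply/colP => a; rewrite !mxE -surjective_pairing.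
by rewrite mxtens_unindexK.
Qed.

(* T_(i_1) ⊗ ... ⊗ T_(i_m) for s = [:: i_1; ...; i_m] *)
Fixpoint kronT n (T : forall j, 'M[R]_(n, n ^ j)) (s : seq nat) :
    'M[R]_(n ^ size s, n ^ sumn s) :=
  if s is j :: s' then
    castmx (esym (expnS n (size s')), esym (expnD n j (sumn s')))
      (T j *t kronT T s')
  else 1%:M.

(* The calligraphic T_(m,l). The sum ranges over the m-tuples of positive
   integers with sum l; the dimensions agree for each such tuple, so that
   conform_mx is a cast and its default value 0 is never used. *)
Definition calT n (T : forall j, 'M[R]_(n, n ^ j)) (m l : nat) :
    'M[R]_(n ^ m, n ^ l) :=
  \sum_(s : m.-tuple 'I_l.+1 |
          all (leq 1) (map val s) && (sumn (map val s) == l))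
    conform_mx 0 (kronT T (map val s)).

(* vec (T_j^T W T_i), seen in R^(n^N); only used with i + j = N, in which case
   n^i * n^j = n^N and conform_mx is a cast. *)
Definition vecTWT n (W : 'M[R]_n) (T : forall j, 'M[R]_(n, n ^ j))
    (N j i : nat) : 'cV[R]_(n ^ N) :=
  conform_mx 0 (vec ((T j)^T *m W *m T i)).

Lemma vecTWTE n (W : 'M[R]_n) (T : forall j, 'M[R]_(n, n ^ j)) j i :
  vecTWT W T (i + j) j i =
  castmx (esym (expnD n i j), erefl) (vec ((T j)^T *m W *m T i)).
Proof.
rewrite /vecTWT; move: (vec _) (esym _) => A e.
by case: _ / e; rewrite conform_mx_id castmx_id.
Qed.

Definition Mcoef n (V2 : 'M[R]_n) (v : forall i, 'cV[R]_(n ^ i))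
    (T : forall j, 'M[R]_(n, n ^ j)) (k : nat) : 'cV[R]_(n ^ k.+1) :=
  \sum_(2 <= i < k.+2) \sum_(2 <= j < k.+2 | (i + j == k.+1)%N)
     vecTWT V2 T k.+1 j i
  + \sum_(3 <= i < k.+2) (calT T i k.+1)^T *m v i.

Definition Ccoef n (W2 : 'M[R]_n) (w : forall i, 'cV[R]_(n ^ i))
    (T : forall j, 'M[R]_(n, n ^ j)) (k : nat) : 'cV[R]_(n ^ k.+2) :=
  \sum_(1 <= i < k.+3) \sum_(1 <= j < k.+3 | (i + j == k.+2)%N)
     vecTWT W2 T k.+2 j i
  + \sum_(3 <= i < k.+3) (calT T i k.+2)^T *m w i.

(* (C)_J for an index set given by the increasing list J of its elements,
   which are 1-based indices; the value 0 is for out-of-range indices. *)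
Definition subvec n N (C : 'cV[R]_N) (J : seq nat) : 'cV[R]_n :=
  \col_(i < n) if insub (nth 0%N J i).-1 is Some a then C a 0 else 0.

End Kronecker.

(* The index set {(i - 1) s + i | i = 1, ..., n}, as an increasing list. *)
Definition idxset (n s : nat) : seq nat :=
  [seq (i.-1 * s + i)%N | i <- iota 1 n].

Lemma idxset_sorted n s : sorted ltn (idxset n s).
Proof.
apply: (homo_sorted (e := ltn)) (iota_ltn_sorted 1 n) => i j /= ij.
by rewrite -addnS leq_add // leq_mul2r -!subn1 leq_sub2r ?orbT // ltnW.
Qed.

Lemma idxset_bound n k j :
  j \in idxset n (\sum_(1 <= l < k.+2) n ^ l)%N -> (0 < j <= n ^ k.+2)%N.
Proof.
case/mapP => i; rewrite mem_iota add1n ltnS => /andP[i_gt0 le_in] ->.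
rewrite addn_gt0 i_gt0 orbT /=.
have -> : (n ^ k.+2 = (n.-1 * \sum_(1 <= l < k.+2) n ^ l + n))%N.
  have n_gt0 : (0 < n)%N by apply: leq_trans le_in.
  elim: k => [|k IHk]; last first.
    by rewrite big_nat_recr //= mulnDr addnAC -IHk -mulSn prednK // -expnS.
  by rewrite big_nat1 expn1 -mulSnr prednK // mulnn.
by rewrite leq_add // leq_mul2r -!subn1 leq_sub2r ?orbT.
Qed.

Section Energy.
Variable R : realType.

Definition spd n (A : 'M[R]_n) : Prop :=
  A^T = A /\ forall x : 'cV[R]_n, x != 0 -> 0 < (x^T *m A *m x) 0 0.

Definition is_cholesky n (A L : 'M[R]_n) : Prop :=
  [/\ is_trig_mx L, forall i, 0 < L i i & A = L *m L^T].

Definition is_orthomx n (A : 'M[R]_n) : Prop := A^T *m A = 1%:M.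

(* Coefficients of a polynomial energy function of degree at most d; the
   components of index 0 and 1 play no role. *)
Definition energy_coef n d (v : forall i, 'cV[R]_(n ^ i)) : Prop :=
  [/\ forall i, (2 <= i <= d)%N -> symmetric_coef (v i),
      forall i, (d < i)%N -> v i = 0
    & spd (unvec (v 2%N) : 'M_n)].

Definition zvec n : 'cV[{mpoly R[n]}]_n := \col_i 'X_i.

(* (1/2) \sum_(2 <= i <= d) v_i^T x^(⊗ i), as a polynomial in x_1, ..., x_n *)
Definition energy n d (v : forall i, 'cV[R]_(n ^ i)) : {mpoly R[n]} :=
  2^-1 *: \sum_(2 <= i < d.+1)
    ((map_mx (@mpolyC n R) (v i))^T *m kronpow (zvec n) i) 0 0.

Lemma energyE n d (v : forall i, 'cV[R]_(n ^ i)) (x : 'cV[R]_n) :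
  (energy d v).@[fun i => x i 0] =
  2^-1 * \sum_(2 <= i < d.+1) ((v i)^T *m kronpow x i) 0 0.
Proof.
rewrite /energy mevalZ raddf_sum /=; congr (_ * _); apply: eq_bigr => i _.
rewrite !mxE raddf_sum /=; apply: eq_bigr => j _.
rewrite mevalM !mxE mevalC; congr (_ * _).
rewrite !castmxE /=; move: (cast_ord _ _) (cast_ord _ _) => {j} a b.
case: i a b => [|i] a b; first by rewrite /ntensmx !mxE rmorph_nat.
elim: i a b => [|i IHi] a b; first by rewrite !ntensmx1 !mxE mevalXU (ord1 a).
rewrite !ntensmxSS ![(_ *t _) _ _]mxE mevalM IHi mxE mevalXU.
by rewrite [(mxtens_unindex a).1]ord1.
Qed.

Definition Phi n K (T : forall j, 'M[R]_(n, n ^ j)) : n.-tuple {mpoly R[n]} :=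
  [tuple (\sum_(1 <= k < K.+1)
            map_mx (@mpolyC n R) (T k) *m kronpow (zvec n) k) i 0 | i < n].

(* xi_i, as a polynomial in its single variable *)
Definition svfun n l (xi0 : 'rV[R]_n) (c : nat -> 'cV[R]_n) (i : 'I_n) :
    {poly R} :=
  (xi0 0 i)%:P + \sum_(1 <= k < l.+1) c k i 0 *: 'X^k.

Definition svfun_at n l (xi0 : 'rV[R]_n) (c : nat -> 'cV[R]_n) (i : 'I_n) :
    {mpoly R[n]} :=
  (map_poly (@mpolyC n R) (svfun l xi0 c i)).['X_i].

End Energy.

(* Main.v *)
(* Only the monomials z_i^(k+2) matter, so everything may be restricted to the
   coordinate axes, i.e., mapped to univariate polynomials by z_j = 0 for
   j <> i.  Along the i-th axis Phi becomes \sum_k t^k T_k e_i^(⊗ k), and the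
   coefficient of t^(k+2) in 2 E^+ is the entry of C_k at the position of
   e_i^(⊗ (k+2)), which is what the index set I_k selects; on the other side
   only z_i^2 xi_i(z_i)^2 survives, with coefficient
   2 xi_i(0) c_i^(k) + \sum_(a + b = k) c_i^(a) c_i^(b).  A part of a
   composition of k+2 into at least two positive parts is at most k+1 <= K, so
   truncating Phi at degree K is harmless.  For k = 1 the two quadratic terms
   coincide because W_2 is symmetric. *)

Require Import Defs.
From HB Require Import structures.
From mathcomp Require Import all_boot all_order all_fingroup all_algebra.
From mathcomp Require Import reals.
From mathcomp Require Import mxtens mpoly.
From mathcomp Require Import zify.
Set Implicit Arguments.
Unset Strict Implicit.
Unset Printing Implicit Defensive.
Import Order.TTheory GRing.Theory Num.Theory.
Local Open Scope ring_scope.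


(** * Matrix entries at natural-number indices *)

Section Entry.
Variable R : nmodType.

(* Indexing by natural numbers makes entries insensitive to the casts between
   equal dimensions. *)
Definition entry p q (A : 'M[R]_(p, q)) (a b : nat) : R :=
  if insub a is Some i then if insub b is Some j then A i j else 0 else 0.

Lemma entryE p q (A : 'M[R]_(p, q)) (i : 'I_p) (j : 'I_q) : entry A i j = A i j.
Proof. by rewrite /entry !valK. Qed.

Lemma entry_col p (A : 'cV[R]_p) (i : 'I_p) : entry A i 0 = A i 0.
Proof. by rewrite -(entryE A i 0). Qed.

Lemma entry_cast p q p' q' (e : (p = p') * (q = q')) (A : 'M[R]_(p, q)) a b :
  entry (castmx e A) a b = entry A a b.
Proof.
by case: e => ep eq; case: p' / ep; case: q' / eq; rewrite castmx_id.
Qed.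

Lemma entry_conform p q p' q' (A : 'M[R]_(p, q)) a b : p = p' -> q = q' ->
  entry (conform_mx (0 : 'M_(p', q')) A) a b = entry A a b.
Proof.
by move=> ep eq; case: p' / ep; case: q' / eq; rewrite conform_mx_id.
Qed.

Lemma entryD p q (A B : 'M[R]_(p, q)) a b :
  entry (A + B) a b = entry A a b + entry B a b.
Proof.
rewrite /entry; case: (insub a : option 'I_p) => [i|];
  case: (insub b : option 'I_q) => [j|]; rewrite ?addr0 //.
by rewrite mxE.
Qed.

Lemma entry_tr p q (A : 'M[R]_(p, q)) a b : entry A^T a b = entry A b a.
Proof.
by rewrite /entry; case: (insub b : option 'I_p) => [i|];
  case: (insub a : option 'I_q) => [j|]; rewrite ?mxE.
Qed.

Lemma entry0 p q a b : entry (0 : 'M[R]_(p, q)) a b = 0.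
Proof.
by rewrite /entry; case: (insub a : option 'I_p) => [i|];
  case: (insub b : option 'I_q) => [j|]; rewrite ?mxE.
Qed.

Lemma entry_sum I r (P : pred I) p q (F : I -> 'M[R]_(p, q)) a b :
  entry (\sum_(i <- r | P i) F i) a b = \sum_(i <- r | P i) entry (F i) a b.
Proof.
apply: (big_morph (fun A => entry A a b)); last exact: entry0.
by move=> A B; exact: entryD.
Qed.
End Entry.

Lemma entry_map (R S : nmodType) (f : {additive R -> S}) p q
    (A : 'M[R]_(p, q)) a b :
  entry (map_mx f A) a b = f (entry A a b).
Proof.
by rewrite /entry; case: (insub a : option 'I_p) => [i|];
  case: (insub b : option 'I_q) => [j|]; rewrite ?mxE ?raddf0.
Qed.

(** * Entries of products, Kronecker products and Kronecker powers *)

Section KroneckerEntry.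
Variable R : comNzRingType.

Lemma entry_scale p q c (A : 'M[R]_(p, q)) a b :
  entry (c *: A) a b = c * entry A a b.
Proof.
rewrite /entry; case: (insub a : option 'I_p) => [i|];
  case: (insub b : option 'I_q) => [j|]; rewrite ?mulr0 //.
by rewrite mxE.
Qed.

Lemma entry_mul p q r (A : 'M[R]_(p, q)) (B : 'M[R]_(q, r)) a b :
  entry (A *m B) a b = \sum_(j < q) entry A a j * entry B j b.
Proof.
rewrite {1}/entry; case: insubP => [i _ <-|a_ge]; last first.
  by rewrite big1 // => j _; rewrite {1}/entry insubN ?mul0r.
case: insubP => [k _ <-|b_ge]; last first.
  by rewrite big1 // => j _; rewrite {2}/entry valK insubN ?mulr0.
by rewrite mxE; apply: eq_bigr => j _; rewrite !entryE.
Qed.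

(** Out-of-range indices are covered too: the quotient is then itself out of range, so both sides
    are 0. *)
Lemma entry_tens p q p' q' (A : 'M[R]_(p, q)) (B : 'M[R]_(p', q')) a b :
    (0 < p')%N -> (0 < q')%N ->
  entry (A *t B) a b =
  entry A (a %/ p') (b %/ q') * entry B (a %% p') (b %% q').
Proof.
move=> p'_gt0 q'_gt0; rewrite {1}/entry.
case: insubP => [i _ <-|a_ge]; last first.
  by rewrite {1}/entry insubN ?mul0r // ltn_divLR.
case: insubP => [k _ <-|b_ge]; last first.
  rewrite {1}/entry [insub (b %/ _)%N]insubN ?ltn_divLR //.
  by case: insub; rewrite mul0r.
by rewrite mxE -!entryE.
Qed.

Lemma entry_kronpow0 m (x : 'cV[R]_m) a :
  entry (kronpow x 0) a 0 = (a == 0)%:R.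
Proof.
rewrite entry_cast /ntensmx /entry; case: insubP => [i _ <-|]; last by case: a.
by rewrite (valK (0 : 'I_1)) mxE (ord1 i).
Qed.

Lemma entry_kronpowS m (x : 'cV[R]_m) k a : (0 < m)%N ->
  entry (kronpow x k.+1) a 0 =
  entry x (a %/ m ^ k) 0 * entry (kronpow x k) (a %% m ^ k) 0.
Proof.
move=> m_gt0; case: k => [|k].
  by rewrite entry_kronpow0 entry_cast ntensmx1 divn1 modn1 mulr1.
rewrite !entry_cast ntensmxSS.
by rewrite entry_tens ?(expn_gt0 _ k.+1) ?m_gt0 // div0n mod0n.
Qed.

Lemma map_kronpow (S : comNzRingType) (f : {rmorphism R -> S}) m
    (x : 'cV[R]_m) k :
  map_mx f (kronpow x k) = kronpow (map_mx f x) k.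
Proof.
rewrite /kronpow map_castmx; congr (castmx _ _).
case: k => [|k]; first by apply/matrixP => i j; rewrite !mxE rmorph_nat.
elim: k => [|k IHk]; first by rewrite !ntensmx1.
by rewrite !ntensmxSS map_mxT IHk.
Qed.

End KroneckerEntry.

(** * Positions of diagonal coefficients and the index sets *)

(* The 0-based position of the coefficient of e_i ⊗ ... ⊗ e_i (k factors) *)
Definition diagpos (n i k : nat) : nat := i * \sum_(l < k) n ^ l.

Lemma diagpos0 n i : diagpos n i 0 = 0%N.
Proof. by rewrite /diagpos big_ord0 muln0. Qed.

Lemma diagposS n i k : diagpos n i k.+1 = (i * n ^ k + diagpos n i k)%N.
Proof. by rewrite /diagpos big_ord_recr mulnDr addnC. Qed.

(** For i < n, [diagpos n i k] is the base-n numeral made of k digits i. Concatenating numerals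
    gives this identity; quotient and remainder by n^k undo it. *)
Lemma diagposD n i j k :
  diagpos n i (j + k) = (diagpos n i j * n ^ k + diagpos n i k)%N.
Proof.
elim: j => [|j IHj]; first by rewrite diagpos0.
by rewrite addSn !diagposS IHj addnA mulnDl -mulnA -expnD.
Qed.

Lemma diagpos_lt n i k : (i < n)%N -> (diagpos n i k < n ^ k)%N.
Proof.
move=> lt_in; elim: k => [|k IHk]; first by rewrite diagpos0.
rewrite diagposS expnS -addnS (leq_trans (leq_add (leqnn _) IHk)) //.
by rewrite addnC -mulSn leq_mul2r lt_in orbT.
Qed.

Lemma diagpos_div n i j k : (i < n)%N ->
  (diagpos n i (j + k) %/ n ^ k)%N = diagpos n i j.
Proof.
move=> lt_in; have lt_k := diagpos_lt k lt_in.
by rewrite diagposD divnMDl ?(leq_ltn_trans _ lt_k) // divn_small ?addn0.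
Qed.

Lemma diagpos_mod n i j k : (i < n)%N ->
  (diagpos n i (j + k) %% n ^ k)%N = diagpos n i k.
Proof. by move=> lt_in; rewrite diagposD modnMDl modn_small ?diagpos_lt. Qed.

Lemma nth_idxset n s (i : 'I_n) : (nth 0 (idxset n s) i).-1 = (i * s + i)%N.
Proof.
by rewrite (nth_map 0%N) ?size_iota // nth_iota // add1n addnS.
Qed.

(** The sum defining the index set starts at n^1; the additional i supplies the missing term i *
    n^0, once the shift from 1-based to 0-based indices is made. *)
Lemma subvecE (R : comNzRingType) n N (C : 'cV[R]_N) k (i : 'I_n) :
  subvec n C (idxset n (\sum_(1 <= m < k.+2) n ^ m)%N) i 0 =
  entry C (diagpos n i k.+2) 0.
Proof.
rewrite mxE nth_idxset /diagpos -(big_mkord xpredT).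
rewrite [in RHS]big_ltn // expn0 mulnDr muln1 addnC /entry; case: insub => // a.
by rewrite (valK (0 : 'I_1)).
Qed.

(** * Sums over antidiagonals and over tuples *)

Section Antidiagonal.
Variable V : nmodType.

(** The condition forces j = N - i, and i = N leaves no positive j. *)
Lemma sum_antidiag N (F : nat -> nat -> V) :
  \sum_(1 <= i < N.+1) \sum_(1 <= j < N.+1 | (i + j == N)%N) F i j =
  \sum_(1 <= i < N) F i (N - i)%N.
Proof.
case: N => [|N]; first by rewrite !big_geq.
rewrite big_nat_recr //= [X in _ + X]big_nat_cond.
rewrite [X in _ + X]big1 => [|j]; last first.
  by case/andP => /andP[j_gt0 _]; rewrite -[X in _ == X]addn0 eqn_add2l gtn_eqF.
rewrite addr0; apply: eq_big_nat => i /andP[i_gt0 lt_iN].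
under eq_bigl => j do rewrite -(subnKC (ltnW lt_iN)) eqn_add2l.
by rewrite big_nat1_eq subn_gt0 lt_iN ltnS leq_subr.
Qed.
End Antidiagonal.

Lemma sum_cons_tuple (V : nmodType) (I : finType) m (P : pred (seq I))
    (F : seq I -> V) :
  \sum_(s : m.+1.-tuple I | P s) F s =
  \sum_(j : I) \sum_(s : m.-tuple I | P (j :: s)) F (j :: s).
Proof.
rewrite pair_big_dep /=.
rewrite (reindex (fun p : I * m.-tuple I => [tuple of p.1 :: p.2])) //=.
exists (fun s : m.+1.-tuple I => (thead s, [tuple of behead s])) => [[j s]|s] _.
  by congr (_, _); apply: val_inj.
by rewrite [RHS]tuple_eta; apply: val_inj.
Qed.

(** * Kronecker powers of the transformation along a coordinate axis *)

Section Axis.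
Variables (R : comNzRingType) (n : nat) (i : 'I_n) (K : nat).
Variable T : forall j, 'M[R]_(n, n ^ j).
Local Notation diag := (diagpos n i).

(* The restriction of Phi to the i-th coordinate axis, as polynomials in the
   coordinate z_i *)
Definition axis_col : 'cV[{poly R}]_n :=
  \col_r \sum_(1 <= k < K.+1) entry (T k) r (diag k) *: 'X^k.

Lemma coef_axis_col a N :
  (entry axis_col a 0)`_N =
  if (0 < N <= K)%N then entry (T N) a (diag N) else 0.
Proof.
case: (ltnP a n) => [lt_an|le_na]; last first.
  by rewrite /entry !insubN -?leqNgt // coef0 if_same.
rewrite -[a]/(val (Ordinal lt_an)); move: (Ordinal lt_an) => r {a lt_an}.
rewrite entry_col mxE coef_sum /=.
under eq_bigr => k _ do rewrite coefZ coefXn mulr_natr mulrb eq_sym.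
by rewrite -big_mkcond big_nat1_eq ltnS.
Qed.

Lemma entry_kronT_cons m j s a : size s = m ->
  entry (kronT T (j :: s)) a (diag (sumn (j :: s))) =
  entry (T j) (a %/ n ^ m) (diag j) *
  entry (kronT T s) (a %% n ^ m) (diag (sumn s)).
Proof.
move=> <-; have n_gt0 : (0 < n)%N by apply: leq_ltn_trans (ltn_ord i).
by rewrite entry_cast entry_tens ?expn_gt0 ?n_gt0 // diagpos_div ?diagpos_mod.
Qed.

(** Expanding the power chooses one [T j] per factor, and the coefficient of degree N collects the
    choices of total degree N. The free bound [L] keeps the index type fixed when the induction
    passes from N to N - j. *)
Lemma coef_kronpow_axis L m N a : (N <= L)%N ->
  (entry (kronpow axis_col m) a 0)`_N =
  \sum_(s : m.-tuple 'I_L.+1 | all (fun j => 0 < j <= K)%N (map val s)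
                               && (sumn (map val s) == N))
    entry (kronT T (map val s)) a (diag N).
Proof.
have n_gt0 : (0 < n)%N by apply: leq_ltn_trans (ltn_ord i).
elim: m N a => [|m IHm] N a le_NL.
  rewrite entry_kronpow0 big_mkcond (big_pred1 [tuple]) /= => [|s]; last first.
    by apply/esym/eqP; rewrite tuple0.
  rewrite -polyC_natr coefC.
  case: N {le_NL} => [|N] //=; rewrite diagpos0 /entry.
  case: insubP => [b _ <-|]; last by case: a.
  by rewrite (valK (0 : 'I_1)) mxE (ord1 b).
rewrite entry_kronpowS // coefM.
rewrite (sum_cons_tuple m (fun s => all (fun j => 0 < j <= K)%N (map val s)
           && (sumn (map val s) == N))
         (fun s => entry (kronT T (map val s)) a (diag N))) /=.
(* The Cauchy product over j <= N is widened to all possible heads j of a tuple; a head with j > N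
   already exceeds the required sum. *)
rewrite (big_ord_widen L.+1 (fun j => (entry axis_col (a %/ n ^ m)%N 0)`_j *
  (entry (kronpow axis_col m) (a %% n ^ m)%N 0)`_(N - j))) // big_mkcond.
apply: eq_bigr => j _; rewrite ltnS.
case: (leqP j N) => [le_jN|lt_Nj]; last first.
  by rewrite big_pred0 // => s; rewrite gtn_eqF ?andbF // ltn_addr.
rewrite coef_axis_col; case: ifP => [_|_]; last by rewrite mul0r big_pred0.
rewrite IHm ?(leq_trans (leq_subr _ _)) // mulr_sumr.
apply: eq_big => [s|s /andP[_ /eqP sum_s]] /=.
  by rewrite -(eqn_add2l j) subnKC.
have sum_js : sumn (val j :: map val s) = N by rewrite /= sum_s subnKC.
by rewrite -sum_s -sum_js (@entry_kronT_cons m) // size_map size_tuple.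
Qed.
End Axis.

(** * Bounds on compositions, splitting of sums, entries of [vec] *)

Lemma leq_size_sumn s : all (leq 1) s -> (size s <= sumn s)%N.
Proof.
elim: s => //= x s IHs /andP[x_gt0 /IHs]; rewrite -add1n; exact: leq_add.
Qed.

(** Each of the remaining [(size s).-1] parts is at least 1. *)
Lemma leq_mem_sumn s j :
  all (leq 1) s -> j \in s -> (j + (size s).-1 <= sumn s)%N.
Proof.
elim: s => //= x s IHs /andP[x_gt0 s_gt0]; rewrite inE => /predU1P[->|js].
  by rewrite leq_add2l leq_size_sumn.
case: s js IHs s_gt0 => // y s js IHs s_gt0.
by rewrite addnS -add1n leq_add // IHs.
Qed.

Lemma sum_mxtens (V : nmodType) p q (F : 'I_(p * q) -> V) :
  \sum_a F a = \sum_(c < p) \sum_(b < q) F (mxtens_index (c, b)).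
Proof.
rewrite pair_bigA /= (reindex (@mxtens_index p q)); last first.
  by exists (@mxtens_unindex p q) => x _;
    rewrite ?mxtens_indexK ?mxtens_unindexK.
by apply: eq_bigr => -[].
Qed.

Lemma sum_ends (V : nmodType) N (G : nat -> V) : (0 < N)%N ->
  \sum_(q < N.+1) G q = G 0%N + \sum_(1 <= q < N) G q + G N.
Proof.
by move=> N_gt0; rewrite -(big_mkord xpredT) big_nat_recr // big_ltn.
Qed.

Lemma entry_vec (R : comNzRingType) m p (A : 'M[R]_(m, p)) a : (0 < m)%N ->
  entry (vec A) a 0 = entry A (a %% m) (a %/ m).
Proof.
move=> m_gt0; rewrite {1}/entry; case: insubP => [i _ <-|a_ge].
  by rewrite (valK (0 : 'I_1)) mxE -entryE.
rewrite /entry [insub (a %/ m)%N]insubN ?ltn_divLR //.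
by case: (insub _ : option 'I_m).
Qed.

(** * Coefficients of the energy along an axis *)

Section CoefEnergy.
Variables (R : comNzRingType) (n : nat) (i : 'I_n) (K : nat).
Variable T : forall j, 'M[R]_(n, n ^ j).
Local Notation diag := (diagpos n i).
Local Notation axis := (axis_col i K T).

Definition energy_term m (w : 'cV[R]_(n ^ m)) : {poly R} :=
  ((map_mx (@polyC R) w)^T *m kronpow axis m) 0 0.

Lemma coef_energy_term m (w : 'cV[R]_(n ^ m)) N :
  (energy_term w)`_N =
  \sum_(a < n ^ m) w a 0 * (entry (kronpow axis m) a 0)`_N.
Proof.
rewrite /energy_term mxE coef_sum; apply: eq_bigr => a _.
by rewrite entry_col !mxE coefCM.
Qed.

(** With m >= 2 positive parts of sum N <= K + 1, no part exceeds K, so the truncated transformation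
    produces all of [calT T m N]. *)
Lemma coef_energy_term_calT m (w : 'cV[R]_(n ^ m)) N :
    (2 <= m)%N -> (N <= K.+1)%N ->
  (energy_term w)`_N = entry ((calT T m N)^T *m w) (diag N) 0.
Proof.
move=> m_ge2 le_NK; rewrite coef_energy_term entry_mul; apply: eq_bigr => a _.
rewrite [entry w a 0]entry_col mulrC; congr (_ * _).
rewrite (coef_kronpow_axis _ _ _ _ _ (leqnn N)) entry_tr entry_sum.
apply: eq_big => [s|s /andP[_ /eqP sum_s]]; last first.
  by rewrite entry_conform ?sum_s // size_map size_tuple.
case: eqP => [sum_s|]; rewrite ?andbF // !andbT.
apply/idP/idP => [|s_gt0]; first by apply: sub_all => j /andP[].
apply/allP => j js; rewrite (allP s_gt0) //=.
have := leq_mem_sumn s_gt0 js; rewrite sum_s size_map size_tuple => le_jN.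
rewrite -ltnS (leq_trans _ le_NK) // (leq_trans _ le_jN) // -addn1 leq_add2l.
by case: m m_ge2 {w s sum_s s_gt0 js le_jN a} => [|[]].
Qed.

Lemma calT_gt m N : (N < m)%N -> calT T m N = 0.
Proof.
move=> lt_Nm; rewrite /calT big_pred0 // => s.
apply/negP => /andP[s_gt0 /eqP sum_s]; have := leq_size_sumn s_gt0.
by rewrite sum_s size_map size_tuple leqNgt lt_Nm.
Qed.

(** Since [vec] stacks columns, the all-i numeral of length N splits into row [diag j] (remainder)
    and column [diag k] (quotient). *)
Lemma entry_vecTWT (W : 'M[R]_n) N j k : (k + j = N)%N ->
  entry (vecTWT W T N j k) (diag N) 0 =
  \sum_(c < n) \sum_(b < n)
    W b c * (entry (T k) c (diag k) * entry (T j) b (diag j)).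
Proof.
move=> <-; have n_gt0 : (0 < n)%N by apply: leq_ltn_trans (ltn_ord i).
rewrite entry_conform ?expnD // entry_vec ?expn_gt0 ?n_gt0 //.
rewrite diagpos_mod // diagpos_div // entry_mul; apply: eq_bigr => c _.
rewrite entry_mul mulr_suml; apply: eq_bigr => b _.
by rewrite entry_tr entryE mulrC mulrCA mulrA mulrC mulrCA mulrC -mulrA.
Qed.

Lemma coef_energy_term2 (w : 'cV[R]_(n ^ 2)) N : (0 < N <= K.+1)%N ->
  (energy_term w)`_N =
  entry (\sum_(1 <= k < N.+1) \sum_(1 <= j < N.+1 | (k + j == N)%N)
           vecTWT (unvec w) T N j k) (diag N) 0.
Proof.
case/andP=> N_gt0 le_NK.
have n_gt0 : (0 < n)%N by apply: leq_ltn_trans (ltn_ord i).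
rewrite sum_antidiag entry_sum coef_energy_term.
pose E q (c : 'I_n) := (entry axis c 0)`_q.
pose G q := \sum_(c < n) \sum_(b < n) unvec w b c * (E q c * E (N - q)%N b).
transitivity (\sum_(q < N.+1) G q).
  rewrite (@sum_mxtens _ n n) [RHS]exchange_big; apply: eq_bigr => c _.
  rewrite [RHS]exchange_big; apply: eq_bigr => b _.
  rewrite mxE -mulr_sumr; congr (_ * _).
  rewrite !entry_kronpowS // entry_kronpow0 expn1 expn0 modn1 divn1 mulr1 /=.
  rewrite divnMDl // modnMDl divn_small // modn_small // addn0.
  by rewrite coefM.
(* The restricted transformation has no constant term, which kills both end terms of the Cauchy
   product. *)
have E0 c : E 0%N c = 0 by rewrite /E coef_axis_col.
have G0 : G 0%N = 0.
  by rewrite /G big1 // => c _; rewrite big1 // => b _; rewrite E0 mul0r mulr0.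
have GN : G N = 0.
  by rewrite /G big1 // => c _; rewrite big1 // => b _; rewrite subnn E0 !mulr0.
rewrite (sum_ends G N_gt0) G0 GN addr0 add0r.
apply: eq_big_nat => q /andP[q_gt0 lt_qN].
rewrite entry_vecTWT ?subnKC ?(ltnW lt_qN) //.
apply: eq_bigr => c _; apply: eq_bigr => b _.
(* From 0 < q < N <= K + 1, both q and N - q lie between 1 and K. *)
rewrite /E !coef_axis_col q_gt0 subn_gt0 lt_qN.
rewrite -ltnS (leq_trans lt_qN le_NK) leq_subLR (leq_trans le_NK) //.
by rewrite -add1n leq_add2r.
Qed.

Lemma coef_energy_axis d (w : forall m, 'cV[R]_(n ^ m)) k :
    (2 <= d)%N -> (forall m, (d < m)%N -> w m = 0) -> (k < K)%N ->
  (\sum_(2 <= m < d.+1) energy_term (w m))`_k.+2 =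
  entry (Ccoef (unvec (w 2%N)) w T k) (diag k.+2) 0.
Proof.
move=> d_ge2 w0 lt_kK; rewrite coef_sum big_ltn // /Ccoef entryD.
rewrite coef_energy_term2 //; congr (_ + _).
rewrite entry_sum.
pose G m := entry ((calT T m k.+2)^T *m w m) (diag k.+2) 0.
transitivity (\sum_(3 <= m < d.+1) G m).
  apply: eq_big_nat => m /andP[m_gt2 _].
  by rewrite coef_energy_term_calT // ltnW.
(* The two sums stop at d and at k + 2. Both are padded with zeros to a common bound: [w m] vanishes
   for m > d, and [calT T m k.+2] for m > k + 2. *)
have extend p q : (3 <= p)%N -> (forall m, (p <= m)%N -> G m = 0) ->
    \sum_(3 <= m < p) G m = \sum_(3 <= m < p + q) G m.
  move=> p_ge3 G0; rewrite [RHS](big_cat_nat p_ge3) ?leq_addr //=.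
  rewrite [X in _ + X]big_nat_cond [X in _ + X]big1 ?addr0 // => m.
  by case/andP=> /andP[/G0].
rewrite (extend _ k.+3) // => [|m d_m]; last by rewrite /G w0 // mulmx0 entry0.
rewrite (extend k.+3 d.+1) // => [|m k_m]; last first.
  by rewrite /G calT_gt // trmx0 mul0mx entry0.
by rewrite addnC.
Qed.
End CoefEnergy.

(** * Restriction to a coordinate axis as a ring morphism *)

(** For x = t e_i, an entry of the power is a product over the base-n digits of its position,
    nonzero only if every digit is i. *)
Lemma entry_kronpow_axis (R : comNzRingType) n (i : 'I_n) (x : 'cV[R]_n)
    (t : R) k a :
    (forall j, x j 0 = if j == i then t else 0) -> (a < n ^ k)%N ->
  entry (kronpow x k) a 0 = if a == diagpos n i k then t ^+ k else 0.
Proof.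
move=> xE; have n_gt0 : (0 < n)%N by apply: leq_ltn_trans (ltn_ord i).
elim: k a => [|k IHk] a a_lt.
  move: a_lt; rewrite entry_kronpow0 diagpos0 expr0 expn0 ltnS leqn0.
  by move=> /eqP->.
have lt_div : (a %/ n ^ k < n)%N.
  by rewrite ltn_divLR ?expn_gt0 ?n_gt0 // -expnS.
rewrite entry_kronpowS // IHk ?ltn_pmod ?expn_gt0 ?n_gt0 // diagposS.
rewrite -[(a %/ _)%N]/(val (Ordinal lt_div)) entry_col xE -val_eqE /= exprS.
have lt_diag := diagpos_lt k (ltn_ord i).
have -> : (a == i * n ^ k + diagpos n i k)%N =
          (a %/ n ^ k == i)%N && (a %% n ^ k == diagpos n i k)%N.
  apply/eqP/andP => [->|[/eqP <- /eqP <-]]; last exact: divn_eq.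
  rewrite divnMDl ?expn_gt0 ?n_gt0 // divn_small // addn0.
  by rewrite modnMDl modn_small ?eqxx.
by case: eqP => _; case: eqP => _; rewrite ?(mul0r, mulr0).
Qed.

Section AxisMorphism.
Variables (R : comNzRingType) (n : nat) (i : 'I_n).

Definition axis_var (j : 'I_n) : {poly R} := if j == i then 'X else 0.

Local Notation restr := (mmap (@polyC R) axis_var).

(** A monomial involving some z_j with j <> i is sent to 0, while each power of z_i is sent to the
    same power of ['X]. *)
Lemma coef_restr (p : {mpoly R[n]}) N : (restr p)`_N = p@_(U_(i) *+ N).
Proof.
rewrite [in RHS](mpolyE p) raddf_sum /mmap coef_sum /=; apply: eq_bigr => m _.
rewrite coefCM mcoeffZ mcoeffX /mmap1 (bigD1 i) //= {1}/axis_var eqxx.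
congr (_ * _).
have [/forallP m_axis|] := boolP [forall j, (j != i) ==> (m j == 0%N)].
  have -> : m = (U_(i) *+ m i)%MM.
    apply/mnmP => j; rewrite mulmnE mnm1E; have := m_axis j.
    by case: eqVneq => [->|_ /eqP ->]; rewrite ?mul1n.
  rewrite big1 => [|j ij]; last first.
    by rewrite mulmnE mnm1E eq_sym (negPf ij) expr0.
  rewrite mulr1 coefXn mulmnE mnm1E eqxx mul1n; congr (nat_of_bool _)%:R.
  apply/eqP/eqP => [->//|/(congr1 (fun m : 'X_{1..n} => m i))].
  by rewrite !mulmnE mnm1E eqxx !mul1n.
rewrite negb_forall => /existsP[j]; rewrite negb_imply => /andP[ij mj].
rewrite (bigD1 j) //= /axis_var (negPf ij) expr0n (negPf mj) mul0r mulr0 coef0.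
case: eqP => // m_axis; move: mj.
by rewrite m_axis mulmnE mnm1E [i == j]eq_sym (negPf ij).
Qed.

Lemma restrX j : restr 'X_j = axis_var j.
Proof. by rewrite mmapX mmap1U. Qed.

Lemma restr_horner (p : {poly R}) j :
  restr (map_poly (@mpolyC n R) p).['X_j] = p \Po axis_var j.
Proof.
rewrite -horner_map -map_poly_comp /= restrX /comp_poly; congr _.[_].
by apply: eq_map_poly => x /=; rewrite mmapC.
Qed.

End AxisMorphism.

Section EnergyRestriction.
Variables (R : realType) (n : nat) (i : 'I_n) (K : nat).
Variable T : forall j, 'M[R]_(n, n ^ j).
Local Notation restr := (mmap (@polyC R) (axis_var R i)).

(** Stated for an arbitrary ring morphism so that substituting [Phi] and restricting to an axis can
    be done at once; the factor 2 cancels the 1/2 in [energy]. *)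
Lemma map_energy (S : comNzRingType) (f : {rmorphism {mpoly R[n]} -> S}) d
    (w : forall m, 'cV[R]_(n ^ m)) :
  f (2%:R *: energy d w) = \sum_(2 <= m < d.+1)
    ((map_mx (f \o @mpolyC n R) (w m))^T *m
     kronpow (map_mx f (zvec R n)) m) 0 0.
Proof.
rewrite /energy scalerA mulfV ?pnatr_eq0 // scale1r rmorph_sum.
apply: eq_bigr => m _ /=.
by rewrite -map_kronpow map_mx_comp [in RHS]map_trmx -map_mxM [in RHS]mxE.
Qed.

(** On the axis, the k-th power of z_i e_i has the single nonzero entry z_i^k, so [T k] contributes
    only its column at [diagpos n i k]. *)
Lemma restr_Phi r : restr (tnth (Phi K T) r) = axis_col i K T r 0.
Proof.
rewrite tnth_mktuple summxE rmorph_sum mxE; apply: eq_bigr => k _ /=.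
have term b :
    restr (map_mx (@mpolyC n R) (T k) r b * kronpow (zvec R n) k b 0) =
    if b == Ordinal (diagpos_lt k (ltn_ord i)) then T k r b *: 'X^k else 0.
  rewrite rmorphM [map_mx _ _ _ _]mxE /= mmapC mul_polyC.
  rewrite -[kronpow _ _ _ _]entry_col -entry_map map_kronpow.
  rewrite (@entry_kronpow_axis _ _ i _ 'X) ?ltn_ord // => [|j]; last first.
    by rewrite !mxE; exact: restrX.
  by rewrite -val_eqE /=; case: ifP; rewrite ?scaler0.
rewrite mxE rmorph_sum /= (eq_bigr _ (fun b _ => term b)).
by rewrite -big_mkcond big_pred1_eq -entryE.
Qed.
End EnergyRestriction.

(** The only composition of 3 into three positive parts is 1 + 1 + 1. *)
Lemma entry_calT33 (R : comNzRingType) n (T : forall j, 'M[R]_(n, n ^ j)) a b :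
  (0 < n)%N -> entry (calT T 3 3) a b = entry ((T 1%N : 'M_n) ^t 3) a b.
Proof.
move=> n_gt0; pose s : 3.-tuple 'I_4 := [tuple of nseq 3 (inord 1)].
rewrite entry_sum (big_pred1 s) => [|t].
  rewrite /s /= !inordK // entry_conform // !ntensmxSS ntensmx1.
  rewrite !(entry_cast, entry_tens) ?(muln_gt0, expn_gt0) ?n_gt0 //.
  rewrite /= ![(_ %/ n ^ 0)%N]divn1 ![(_ %% n ^ 0)%N]modn1.
  have -> : entry (1%:M : 'M[R]_(n ^ 0)) 0 0 = 1.
    by apply: etrans (@entryE R 1 1 1%:M 0 0) _; rewrite mxE.
  by rewrite mulr1.
rewrite /pred1 /= -(inj_eq val_inj t s).
case/tupleP: t => x t'; case/tupleP: t' => y t''; case/tupleP: t'' => z t.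
rewrite (tuple0 t) /= !eqseq_cons -!(inj_eq val_inj _ (inord 1)) /= !inordK //.
rewrite eqxx !andbT.
apply/andP/and3P => [|[/eqP-> /eqP-> /eqP->]] //.
case=> /and3P[x_gt0 y_gt0 z_gt0] /eqP sum3.
by split; apply/eqP; lia.
Qed.

(** * The output-diagonal side and the quadratic terms of C_1 *)

Section Singular.
Variables (R : realType) (n : nat) (i : 'I_n).
Local Notation restr := (mmap (@polyC R) (axis_var R i)).

Lemma restr_output l (xi0 : 'rV[R]_n) c :
  restr (\sum_(j < n) 'X_j ^+ 2 * svfun_at l xi0 c j ^+ 2) =
  'X^2 * svfun l xi0 c i ^+ 2.
Proof.
rewrite rmorph_sum (bigD1 i) //= big1 ?addr0 => [|j ij];
  rewrite rmorphM !rmorphXn /= restrX /axis_var.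
  by rewrite eqxx restr_horner /axis_var eqxx comp_polyXr.
by rewrite (negPf ij) expr0n mul0r.
Qed.

Lemma coef_svfun l (xi0 : 'rV[R]_n) c k : (0 < k <= l)%N ->
  (svfun l xi0 c i)`_k = c k i 0.
Proof.
move=> /andP[k_gt0 le_kl]; rewrite coefD coefC gtn_eqF // add0r coef_sum.
under eq_bigr => j _ do rewrite coefZ coefXn mulr_natr mulrb eq_sym.
by rewrite -big_mkcond big_nat1_eq ltnS k_gt0 le_kl.
Qed.

Lemma coef0_svfun l (xi0 : 'rV[R]_n) c : (svfun l xi0 c i)`_0 = xi0 0 i.
Proof.
rewrite coefD coefC coef_sum big_nat_cond big1 ?addr0 // => j.
case/andP=> /andP[j_gt0 _] _.
by rewrite coefZ coefXn eq_sym gtn_eqF ?mulr0.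
Qed.

(** The end terms q = 0 and q = k of the Cauchy square both equal xi_i(0) c_i^(k). *)
Lemma coef_svfun_sqr l (xi0 : 'rV[R]_n) c k : (0 < k <= l)%N ->
  (svfun l xi0 c i ^+ 2)`_k =
  2%:R * (xi0 0 i * c k i 0) + \sum_(1 <= q < k) c q i 0 * c (k - q)%N i 0.
Proof.
move=> /andP[k_gt0 le_kl]; rewrite expr2 coefM.
pose p := svfun l xi0 c i.
rewrite -/p (sum_ends (fun q => p`_q * p`_(k - q)) k_gt0).
rewrite subn0 subnn /p coef0_svfun coef_svfun ?k_gt0 //.
rewrite [c k i 0 * _]mulrC addrAC.
rewrite mulr_natl mulr2n; congr (_ + _).
apply: eq_big_nat => q /andP[q_gt0 lt_qk].
have le_ql := leq_trans (ltnW lt_qk) le_kl.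
have le_kql := leq_trans (leq_subr q k) le_kl.
by rewrite !coef_svfun ?q_gt0 ?subn_gt0 ?lt_qk.
Qed.
End Singular.

Lemma mul_invmx_diag (F : fieldType) n (d : 'rV[F]_n) (x y : 'cV[F]_n) :
  (forall i, d 0 i != 0) -> (forall i, y i 0 = d 0 i * x i 0) ->
  invmx (diag_mx d) *m y = x.
Proof.
move=> d_neq0 yE; have -> : y = diag_mx d *m x.
  by apply/colP => i; rewrite yE mul_diag_mx mxE.
by rewrite mulKmx // unitmxE det_diag unitfE; apply/prodf_neq0.
Qed.

(** The compositions 1 + 2 and 2 + 1 give equal terms at a diagonal position, by exchanging the two
    sums and using the symmetry of [W]. *)
Lemma entry_Ccoef1 (R : comNzRingType) n (W : 'M[R]_n)
    (w : forall i, 'cV[R]_(n ^ i)) (T : forall j, 'M[R]_(n, n ^ j)) (i : 'I_n) :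
    W^T = W ->
  entry (Ccoef W w T 1) (diagpos n i 3) 0 =
  2%:R * entry (vec ((T 2%N)^T *m W *m T 1%N)) (diagpos n i 3) 0 +
  entry (((T 1%N : 'M_n) ^t 3)^T *m w 3%N) (diagpos n i 3) 0.
Proof.
move=> W_sym; have n_gt0 : (0 < n)%N by apply: leq_ltn_trans (ltn_ord i).
rewrite /Ccoef entryD; congr (_ + _); last first.
  rewrite big_nat1 !entry_mul; apply: eq_bigr => a _.
  by rewrite !entry_tr entry_calT33.
rewrite sum_antidiag entry_sum big_ltn // big_nat1.
have -> : entry (vec ((T 2%N)^T *m W *m T 1%N)) (diagpos n i 3) 0 =
          entry (vecTWT W T 3 2 1) (diagpos n i 3) 0.
  by rewrite [RHS]entry_conform.
rewrite mulr_natl mulr2n; congr (_ + _).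
rewrite !entry_vecTWT // [LHS]exchange_big /=.
apply: eq_bigr => b _; apply: eq_bigr => c _.
by rewrite -{1}W_sym mxE [X in _ * X]mulrC.
Qed.

(** * Matching the coefficients and solving for c_k *)

Theorem theorem3 (R : realType) (n d l K : nat)
    (n_ge1 : (1 <= n)%N) (d_ge2 : (2 <= d)%N) (l_ge1 : (1 <= l)%N)
    (K_ge : (l + 1 <= K)%N)
    (v w : forall i : nat, 'cV[R]_(n ^ i))
    (hv : energy_coef d v) (hw : energy_coef d w)
    (Rc Lc U V : 'M[R]_n) (xi0 : 'rV[R]_n)
    (T : forall k : nat, 'M[R]_(n, n ^ k))
    (hRc : is_cholesky (unvec (v 2%N)) Rc)
    (hLc : is_cholesky (unvec (w 2%N)) Lc)
    (hU : is_orthomx U) (hV : is_orthomx V)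
    (xi0_gt0 : forall i, 0 < xi0 0 i)
    (hsvd : Lc^T *m (invmx Rc)^T = U *m diag_mx xi0 *m V^T)
    (hT1 : T 1%N = (invmx Rc)^T *m V)
    (hT : forall k, (2 <= k <= K)%N ->
      T k = - 2^-1 *: ((T 1%N : 'M_n) *m
              (unvec (castmx (expnS n k, erefl 1%N)
                        (Mcoef (unvec (v 2%N)) v T k)))^T))
    (c : nat -> 'cV[R]_n)
    (hmatch : forall (i : 'I_n) (k : nat), (1 <= k <= l)%N ->
      (2%:R *: (energy d w \mPo Phi K T))@_(U_(i) *+ k.+2) =
      (\sum_(j < n) 'X_j ^+ 2 * svfun_at l xi0 c j ^+ 2)@_(U_(i) *+ k.+2)) :
  c 1%N = invmx (diag_mx xi0) *m
    subvec n (vec ((T 2%N)^T *m unvec (w 2%N) *m T 1%N)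
              + 2^-1 *: (((T 1%N : 'M_n) ^t 3)^T *m w 3%N))
           (idxset n (n ^ 2 + n)%N)
  /\ forall k : nat, (1 <= k <= l)%N ->
    c k = 2^-1 *: (invmx (diag_mx xi0) *m
      (subvec n (Ccoef (unvec (w 2%N)) w T k)
              (idxset n (\sum_(1 <= m < k.+2) n ^ m)%N)
       - \sum_(1 <= i < k.+1) \sum_(1 <= j < k.+1 | (i + j == k)%N)
           map2_mx *%R (c i) (c j))).
Proof.
case: hw => _ w0 [W_sym _].
have two_neq0 : 2%:R != 0 :> R by rewrite pnatr_eq0.
have xi0_neq0 i : xi0 0 i != 0 by rewrite gt_eqF.
have Ccoef_match (i : 'I_n) k : (1 <= k <= l)%N ->
    entry (Ccoef (unvec (w 2%N)) w T k) (diagpos n i k.+2) 0 =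
    2%:R * (xi0 0 i * c k i 0) + \sum_(1 <= q < k) c q i 0 * c (k - q)%N i 0.
  move=> k_bounds; have := hmatch i k k_bounds.
  (* The factor ['X^2] shifts degree k + 2 to degree k of the squared singular value function. *)
  rewrite -!coef_restr restr_output coefXnM /= subn2 /= coef_svfun_sqr // => <-.
  have lt_kK : (k < K)%N.
    by case/andP: k_bounds => _ le_kl; rewrite (leq_trans _ K_ge) // addn1.
  rewrite -(@coef_energy_axis _ _ _ K _ d) // -comp_mpolyZ.
  (* Substitution of [Phi] followed by restriction to the i-th axis; it sends each variable z_r to
     the r-th entry of [axis_col]. *)
  pose f : {rmorphism {mpoly R[n]} -> {poly R}} :=
    mmap (@polyC R) (axis_var R i) \o comp_mpoly (Phi K T).
  rewrite -[mmap _ _ _]/(f (2%:R *: energy d w)) map_energy.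
  congr (_`_ _).
  have termE m : energy_term i K T (w m) =
    ((map_mx (f \o @mpolyC n R) (w m))^T *m
     kronpow (map_mx f (zvec R n)) m) 0 0.
    rewrite /energy_term; congr (((_^T *m kronpow _ m) : 'M_1) 0 0).
      by apply/matrixP => a b; rewrite !mxE /= /f /= comp_mpolyC mmapC.
    apply/matrixP => r b; rewrite (ord1 b) -restr_Phi !mxE /f /=.
    by rewrite comp_mpolyXU -tnth_nth.
  by rewrite (eq_bigr _ (fun m _ => termE m)).
split.
  apply/esym/mul_invmx_diag => // i.
  have -> : (n ^ 2 + n)%N = (\sum_(1 <= m < 3) n ^ m)%N.
    by rewrite big_ltn // big_nat1 expn1 addnC.
  (* Doubling turns the bracket into the entry of C_1; for k = 1 the convolution in [Ccoef_match] is
     an empty sum. *)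
  rewrite subvecE entryD entry_scale; apply: (mulfI two_neq0).
  rewrite mulrDr mulVKf // -entry_Ccoef1 // Ccoef_match //.
  by rewrite [X in _ + X]big_geq ?addr0.
(* With 1/2 moved inside, it remains to check each coordinate after multiplication by xi_i(0): the
   convolution cancels, leaving half of 2 xi_i(0) c_i^(k). *)
move=> k k_bounds; rewrite scalemxAr; apply/esym/mul_invmx_diag => // i.
rewrite sum_antidiag 2!mxE subvecE Ccoef_match // mxE summxE.
under [X in _ - X]eq_bigr => q _ do rewrite mxE.
by rewrite addrK mulKf.
Qed.
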